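(* There is no nontrivial two-sided ideal in $\mathcal{M}$ (that is, none other than $0$ and $\mathcal{M}$) which is closed under both cct and rct. In particular, there is no nontrivial pc-closed two-sided ideal in $\mathcal{M}$.
   Context: $\mathfrak{X}$ is a fixed compact metrizable space and $\mathfrak{m}$ is a fixed Borel probability measure on $\mathfrak{X}$ whose support is all of $\mathfrak{X}$. $\mathcal{M}=\mathcal{M}_{\mathfrak{X},\mathfrak{m}}$ denotes the Banach $*$-algebra $\mathbf{C}(\mathfrak{X}^2)$ of continuous complex functions on $\mathfrak{X}\times\mathfrak{X}$ with the supremum norm, the multiplication $(f\star g)(x,y)=\int_{\mathfrak{X}}f(x,z)g(z,y)\,d\mathfrak{m}(z)$ and the involution $f^*(x,y)=\overline{f(y,x)}$. Topologies on $\mathcal{M}$: the pointwise convergence topology (pct) is the topology of pointwise convergence on $\mathfrak{X}^2$; the column-wise convergence topology (cct) is the vector topology in which $f_\lambda\to f$ iff $\sup_{x}|f_\lambda(x,y)-f(x,y)|\to0$ for every $y\in\mathfrak{X}$; the row-wise convergence topology (rct) is the vector topology in which $f_\lambda\to f$ iff $\sup_{y}|f_\lambda(x,y)-f(x,y)|\to0$ for every $x\in\mathfrak{X}$. pc-closed means closed in the pct. *)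

(* Defs.v *)
From HB Require Import structures.
From mathcomp Require Import all_boot all_order all_algebra complex.
From mathcomp Require Import all_classical all_reals all_analysis.
Import Order.TTheory GRing.Theory Num.Theory.
Import numFieldNormedType.Exports.

Set Implicit Arguments.
Unset Strict Implicit.
Unset Printing Implicit Defensive.

Local Open Scope classical_set_scope.
Local Open Scope ring_scope.

Definition is_metric (R : realType) (X : Type) (d : X -> X -> R) : Prop :=
  [/\ forall x y, 0 <= d x y,
      forall x y, d x y = 0 <-> x = y,
      forall x y, d x y = d y x
    & forall x y z, d x z <= d x y + d y z].

Definition metrizable (R : realType) (X : topologicalType) : Prop :=
  exists2 d : X -> X -> R, is_metric d &
    forall (x : X) (U : set X),
      nbhs x U <-> exists2 e : R, 0 < e & [set y | d x y < e] `<=` U.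

(* The library's measurable types are pointed, which costs nothing here since a
   probability space is nonempty. *)
Notation borel X := (g_sigma_algebraType (@open X)).

Section support.
Context (R : realType) (X : ptopologicalType).

Definition measure_support (m : {measure set (borel X) -> \bar R}) : set X :=
  [set x | forall U : set X, open_nbhs x U -> (0 < m U)%E].

End support.

Section algebra.
Context (R : realType) (X : ptopologicalType).

(* R[i]^o is R[i] with the topology of its modulus. *)
Definition M_alg : set (X * X -> R[i]^o) := [set f | continuous f].

Definition complex_integral (m : {measure set (borel X) -> \bar R})
    (f : X -> R[i]) : R[i] :=
  Complex (\int[m]_z complex.Re (f z)) (\int[m]_z complex.Im (f z)).

Definition star (m : {measure set (borel X) -> \bar R})
    (f g : X * X -> R[i]^o) : X * X -> R[i]^o :=
  fun p => complex_integral m (fun z => f (p.1, z) * g (z, p.2)).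

Definition two_sided_ideal (m : {measure set (borel X) -> \bar R})
    (I : set (X * X -> R[i]^o)) : Prop :=
  [/\ I `<=` M_alg,
      I 0,
      forall (a : R[i]) f g, I f -> I g -> I (a *: f + g)
    & forall f g, M_alg f -> I g -> I (star m f g) /\ I (star m g f)].

Definition nontrivial_ideal (I : set (X * X -> R[i]^o)) : Prop :=
  I <> [set 0] /\ I <> M_alg.

Definition columns : set_system (X * X) :=
  [set [set p | p.2 = y] | y in [set: X]].
Definition rows : set_system (X * X) :=
  [set [set p | p.1 = x] | x in [set: X]].

(* Closedness in M_alg, for the relative topology induced on M_alg by
   pointwise convergence, resp. by uniform convergence on each column
   and on each row. *)
Definition pc_closed (I : set (X * X -> R[i]^o)) : Prop :=
  closed (I : set (subspace (M_alg : set {ptws X * X -> R[i]^o}))).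
Definition cc_closed (I : set (X * X -> R[i]^o)) : Prop :=
  closed (I : set (subspace (M_alg : set {family columns, X * X -> R[i]^o}))).
Definition rc_closed (I : set (X * X -> R[i]^o)) : Prop :=
  closed (I : set (subspace (M_alg : set {family rows, X * X -> R[i]^o}))).

End algebra.

(* Main.v *)
(* A nonzero ideal contains every elementary tensor u (x) v, so it meets the
   functions agreeing with a given f on any finite set of columns: metrizability
   separates the columns, and f is corrected on one column at a time by
   (f - h)(-, y) (x) v. Closedness for the column-wise topology alone, or for
   the pointwise one, then forces the ideal to be everything. *)
Require Import Defs.
From mathcomp Require Import all_boot all_order all_algebra complex.
From mathcomp Require Import all_classical all_reals all_analysis.
From mathcomp Require Import measurable_realfun.
Import Order.TTheory GRing.Theory Num.Theory.
Import numFieldNormedType.Exports.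

Set Implicit Arguments.
Unset Strict Implicit.
Unset Printing Implicit Defensive.

Local Open Scope classical_set_scope.
Local Open Scope ring_scope.

(** * Continuity of the real and imaginary parts, of conjugation and of the embedding of the
    reals *)

Section complex_continuity.
Context (R : realType).

(** The modulus on [R[i]] takes values in [R[i]], so a real epsilon has to be embedded before it can
    bound a distance in the source. *)
Lemma contraction_continuous (f : R[i]^o -> R^o) :
  (forall z w : R[i], `|f z - f w|%:C%C <= `|z - w|) -> continuous f.
Proof.
move=> fE z; apply/(@cvgrPdist_lt R R^o R[i]^o (nbhs z)) => e e0.
have e0' : 0 < e%:C%C :> R[i] by rewrite ltcR.
have := @cvgr_dist_lt _ R[i]^o R[i]^o (nbhs z) (@nbhs_filter R[i]^o z) id z cvg_id _ e0'.
by apply: filterS => w; rewrite -ltcR; apply: le_lt_trans (fE _ _).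
Qed.

Lemma continuous_Re : continuous (@complex.Re R : R[i]^o -> R^o).
Proof.
apply: contraction_continuous => z w.
by apply: le_trans (normc_ge_Re _); case: z w => [? ?] [? ?].
Qed.

Lemma continuous_Im : continuous (@complex.Im R : R[i]^o -> R^o).
Proof.
apply: contraction_continuous => -[a b] [c d] /=.
by rewrite normc_def lecR /= -sqrtr_sqr ler_wsqrtr// lerDr sqr_ge0.
Qed.

Lemma continuous_conjc : continuous (@conjc R : R[i]^o -> R[i]^o).
Proof.
move=> z; apply/(@cvgrPdist_lt _ R[i]^o R[i]^o (nbhs z)) => e e0.
have := @cvgr_dist_lt _ R[i]^o R[i]^o (nbhs z) (@nbhs_filter R[i]^o z) id z cvg_id _ e0.
by apply: filterS => w; rewrite -rmorphB normcJ.
Qed.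

Lemma continuous_real_complex :
  continuous ((fun x => x%:C%C) : R^o -> R[i]^o).
Proof.
move=> x; apply/(@cvgrPdist_lt _ R[i]^o R^o (nbhs x)) => e e0.
(* A positive element of [R[i]] is real, so this epsilon comes from a real one. *)
have er : e = (complex.Re e)%:C%C by rewrite RRe_real// gtr0_real.
have e0' : 0 < complex.Re e by rewrite -ltcR -er.
have := @cvgr_dist_lt _ R^o R^o (nbhs x) (@nbhs_filter R^o x) id x cvg_id _ e0'.
apply: filterS => w.
by rewrite -rmorphB normc_def /= expr0n addr0 sqrtr_sqr er ltcR.
Qed.

End complex_continuity.

(** * Integration of continuous functions over a compact probability space *)

Section integral.
Context (R : realType) (X : ptopologicalType) (m : probability (borel X) R).
Hypothesis X_compact : compact [set: X].

(** Compactness makes [f] bounded, and preimages of open intervals are open, hence Borel; bounded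
    measurable functions are integrable for a finite measure. *)
Lemma continuous_integrable (f : X -> R^o) :
  continuous f -> m.-integrable [set: borel X] (EFin \o f).
Proof.
move=> cf; apply: measurable_bounded_integrable => //.
- by rewrite (le_lt_trans (probability_le1 _ _))// ltry.
- apply: (measurability _ (RGenOpens.measurableE R)).
  move=> _ [_ [a [b ->] <-]]; rewrite setTI.
  apply: sub_sigma_algebra => /=.
  by move/continuousP: cf; apply; exact: interval_open.
- have := compact_bounded (continuous_compact (continuous_subspaceT cf) X_compact).
  move=> [M [Mr HM]]; exists M; split => // x Mx y _.
  by apply: HM => //; exists y.
Qed.

(** The integral is defined by real and imaginary parts, so complex homogeneity reduces to real
    linearity on each part of the product; continuity supplies the integrability this needs. *)
Lemma complex_integralZl (a : R[i]) (f : X -> R[i]^o) : continuous f ->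
  complex_integral m (fun z => a * f z) = a * complex_integral m f.
Proof.
move=> cf.
have cre : continuous (fun z => complex.Re (f z) : R^o).
  by move=> z; apply: continuous_comp; [exact: cf|exact: continuous_Re].
have cim : continuous (fun z => complex.Im (f z) : R^o).
  by move=> z; apply: continuous_comp; [exact: cf|exact: continuous_Im].
have mT : measurable [set: borel X] by [].
have Zl k (g : X -> R^o) : continuous g ->
    m.-integrable [set: borel X] (EFin \o (fun z => k * g z)).
  move=> cg; apply: continuous_integrable => z.
  by apply: (@continuousM R^o) => //; [exact: cst_continuous|exact: cg].
case: a => a b; rewrite /complex_integral; congr Complex.
- transitivity (\int[m]_z (a * complex.Re (f z) - b * complex.Im (f z))).
    by apply: eq_Rintegral => z _ /=; case: (f z).
  by rewrite RintegralB ?RintegralZl//;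
    first [exact: continuous_integrable | exact: Zl].
- transitivity (\int[m]_z (a * complex.Im (f z) + b * complex.Re (f z))).
    by apply: eq_Rintegral => z _ /=; case: (f z).
  by rewrite RintegralD ?RintegralZl//;
    first [exact: continuous_integrable | exact: Zl].
Qed.

(** The integrand is the squared modulus of [f]. By continuity it exceeds half its value at [x] on
    an open neighbourhood, which has positive mass because the support is full. *)
Lemma complex_integral_sqr_neq0 (f : X -> R[i]^o) (x : X) :
  measure_support m = [set: X] -> continuous f -> f x != 0 ->
  complex_integral m (fun z => f z * (f z)^*%C) != 0.
Proof.
move=> supp cf fx0.
pose h z : R^o := complex.Re (f z) ^+ 2 + complex.Im (f z) ^+ 2.
have hE z : f z * (f z)^*%C = (h z)%:C%C.
  rewrite /h; case: (f z) => a b; apply/eqP; rewrite eq_complex /=.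
  by rewrite !mulrN opprK -!expr2 (mulrC b a) addNr !eqxx.
have ch : continuous h.
  move=> z; rewrite /h.
  have cre : {for z, continuous (fun z => complex.Re (f z) : R^o)}.
    by apply: continuous_comp; [exact: cf|exact: continuous_Re].
  have cim : {for z, continuous (fun z => complex.Im (f z) : R^o)}.
    by apply: continuous_comp; [exact: cf|exact: continuous_Im].
  exact: cvgD (cvgM cre cre) (cvgM cim cim).
have h0 z : 0 <= h z by rewrite addr_ge0 ?sqr_ge0.
have hx : 0 < h x.
  rewrite lt_neqAle h0 andbT eq_sym.
  apply: contra fx0; rewrite /h paddr_eq0 ?sqr_ge0// !sqrf_eq0.
  by rewrite eq_complex.
pose U := h @^-1` [set t | h x / 2 < t].
have oU : open U.
  by move/continuousP : ch; apply; exact: open_gt.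
have Ux : U x by rewrite /U /= ltr_pdivrMr// ltr_pMr// ltr1n.
have mU : (0 < m U)%E.
  have : measure_support m x by rewrite supp.
  by apply.
have MU : measurable (U : set (borel X)) by apply: sub_sigma_algebra.
have Ufin : m U \is a fin_num by rewrite fin_num_measure.
suff : 0 < \int[m]_z h z.
  move=> i0; rewrite eq_complex negb_and; apply/orP; left => /=.
  rewrite gt_eqF//.
  by under eq_Rintegral do rewrite hE.
(* The integral of [h] over [X] is at least that over [U], which is at least [h x / 2] times the
   mass of [U]. *)
apply: (@lt_le_trans _ _ (h x / 2 * fine (m U))).
  rewrite mulr_gt0 ?divr_gt0//.
  by rewrite fine_gt0// mU ltey_eq Ufin.
rewrite /Rintegral -lee_fin EFinM !fineK//; last first.
  apply: integrable_fin_num => //; exact: continuous_integrable.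
rewrite -integral_cst//.
apply: (@le_trans _ _ (\int[m]_(z in U) (h z)%:E)%E).
  apply: ge0_le_integral => //.
  - by move=> z _; rewrite lee_fin divr_ge0.
  - exact: measurable_funS (measurable_int _ (continuous_integrable ch)).
  - by move=> z Uz; rewrite lee_fin ltW.
apply: ge0_subset_integral => //.
- exact: measurable_int (continuous_integrable ch).
- by move=> z _; rewrite lee_fin.
Qed.

End integral.

(** * Separation of points by the metric, and limits in relatively closed sets *)

Lemma metric_continuous (R : realType) (X : topologicalType) (d : X -> X -> R)
    (w : X) :
  is_metric d ->
  (forall (x : X) (U : set X),
    nbhs x U <-> exists2 e : R, 0 < e & [set y | d x y < e] `<=` U) ->
  continuous ((fun z => d z w) : X -> R^o).
Proof.
move=> [_ _ dsym dtri] dnbhs z.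
apply/(@cvgrPdist_lt _ R^o X (nbhs z)) => e e0.
apply/dnbhs; exists e => //= y; apply: le_lt_trans.
(* Reverse triangle inequality: [d z w] and [d y w] differ by at most [d z y]. *)
by rewrite ler_norml lerNl opprB !lerBlDr {1}(dsym z y) !dtri.
Qed.

(** The function built is the product over [w] in [s] of [d z w / d y w]: each factor is 1 at [y]
    and 0 at [w]. *)
Lemma metrizable_separation (R : realType) (X : ptopologicalType)
    (y : X) (s : seq X) : metrizable R X -> y \notin s ->
  exists v : X -> R[i]^o,
    [/\ continuous v, v y = 1 & forall z, z \in s -> v z = 0].
Proof.
move=> [d dmet dnbhs]; have [_ d0 _ _] := dmet.
elim: s => [_|w s IHs].
  by exists (fun=> 1); split => // z; exact: cst_continuous.
rewrite inE negb_or => /andP[yw /IHs[v [cv vy vs]]].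
exists (fun z => (d z w / d y w)%:C%C * v z); split.
- move=> z; apply: cvgM; last exact: cv.
  apply: (@continuous_comp _ R^o R[i]^o (fun z => d z w / d y w)).
    by apply: cvgMl; exact: metric_continuous.
  exact: continuous_real_complex.
- rewrite vy mulr1 divff//; apply: contra yw => /eqP/d0 ->//.
- move=> z; rewrite inE => /predU1P[->|/vs ->]; last by rewrite mulr0.
  by rewrite (d0 w w).2// mul0r mul0r.
Qed.

(** Turns relative closedness into a statement on limits in the ambient space: at a point of [A],
    relative neighbourhoods are traces of ambient ones, and each meets [B] because [F] is proper and
    contains [B]. *)
Lemma closed_subspace_cvg (T : topologicalType) (A B : set T)
    (F : set_system T) (x : T) :
  closed (B : set (subspace A)) -> B `<=` A -> F B -> ProperFilter F ->
  A x -> F --> x -> B x.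
Proof.
move=> clB BA FB PF Ax Fx; apply: clB => C.
rewrite [nbhs _](_ : _ = nbhs_subspace (x : subspace A)) //.
rewrite -nbhs_subspace_in // => /Fx FC.
have [y [By Cy]] := filter_ex (filterI FB FC).
by exists y; split=> //; exact/Cy/BA.
Qed.

(** * Two-sided ideals: rank-one kernels, interpolation on finitely many columns, and limits *)

Section ideal.
Context (R : realType) (X : ptopologicalType) (m : probability (borel X) R).
Hypotheses (X_compact : compact [set: X]) (X_metrizable : metrizable R X).
Hypothesis m_support : measure_support m = [set: X].
Implicit Types (f g h : X * X -> R[i]^o) (u v : X -> R[i]^o).

Definition tensor u v : X * X -> R[i]^o := fun p => u p.1 * v p.2.

Lemma M_alg_tensor u v : continuous u -> continuous v -> M_alg (tensor u v).
Proof.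
move=> cu cv [x y]; apply: cvgM.
- by apply: continuous_comp; [exact: cvg_fst|exact: cu].
- by apply: continuous_comp; [exact: cvg_snd|exact: cv].
Qed.

Lemma M_alg_row f x : M_alg f -> continuous (fun y => f (x, y)).
Proof.
move=> cf y; apply: continuous_comp; last exact: cf.
by apply: cvg_pair => //; exact: cvg_cst.
Qed.

Lemma M_alg_column f y : M_alg f -> continuous (fun x => f (x, y)).
Proof.
move=> cf x; apply: continuous_comp; last exact: cf.
by apply: cvg_pair => //; exact: cvg_cst.
Qed.

(** The factor [u x] is constant in the integration variable, so multiplying a rank-one kernel by
    [g] on the right only changes its second factor. *)
Lemma star_tensorl u v g : continuous v -> M_alg g ->
  star m (tensor u v) g =
  tensor u (fun y => complex_integral m (fun z => v z * g (z, y))).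
Proof.
move=> cv Mg; apply/funext => -[x y]; rewrite /star /tensor /=.
have cvzg : continuous ((fun z => v z * g (z, y)) : X -> R[i]^o).
  by move=> z; apply: cvgM; [exact: cv|exact: M_alg_column].
rewrite -(complex_integralZl m X_compact _ cvzg).
by congr complex_integral; apply/funext => z; rewrite mulrA.
Qed.

Context (I : set (X * X -> R[i]^o)).
Hypotheses (idealI : two_sided_ideal m I) (I_neq0 : I <> [set 0]).

(* With c(z) = conj g(z, y0), the function G = c * g does not vanish at y0, so
   the square of its L2-norm is invertible, and
   (u (x) c) * g * (conj G (x) v) = |G|^2 u (x) v. *)
Lemma ideal_tensor u v : continuous u -> continuous v -> I (tensor u v).
Proof.
have [IM I0 _ Istar] := idealI.
move=> cu cv.
have [g Ig [[x0 y0] g0]] : exists2 g, I g & exists p, g p != 0.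
  apply: contrapT => Ig; apply: I_neq0; apply/seteqP; split => [g gI|_ -> //].
  apply/funext => p; apply/eqP/negPn/negP => gp.
  by apply: Ig; exists g => //; exists p.
have Mg := IM _ Ig.
have conj_continuous (t : X -> R[i]^o) : continuous t ->
    continuous ((fun z => (t z)^*%C) : X -> R[i]^o).
  by move=> ct z; apply: continuous_comp; [exact: ct|exact: continuous_conjc].
pose w : X -> R[i]^o := fun z => g (z, y0).
have cw : continuous w by exact: M_alg_column.
pose c : X -> R[i]^o := fun z => (w z)^*%C.
have cc : continuous c by exact: conj_continuous.
pose G : X -> R[i]^o := fun y => complex_integral m (fun z => c z * g (z, y)).
have IG (t : X -> R[i]^o) : continuous t -> I (tensor t G).
  move=> ct; rewrite -star_tensorl//.
  by apply: (Istar _ _ _ Ig).1; exact: M_alg_tensor.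
have cG : continuous G.
  have c1 : continuous ((fun=> 1) : X -> R[i]^o) by exact: cst_continuous.
  (* [G] is a row of the kernel [tensor 1 G], which lies in [I] and so is continuous; no continuity
     theorem for parametric integrals is needed. *)
  rewrite [G](_ : _ = fun y => tensor (fun=> 1) G (point, y)).
    by apply: M_alg_row; apply: IM; exact: IG.
  by apply/funext => y; rewrite /tensor mul1r.
(* [G y0] is the integral of the squared modulus of the column [w], which does not vanish at
   [x0]. *)
have G0 : G y0 != 0.
  rewrite [G y0](_ : _ = complex_integral m (fun z => w z * (w z)^*%C)).
    exact: (@complex_integral_sqr_neq0 _ _ m X_compact w x0).
  by congr complex_integral; apply/funext => z; rewrite mulrC.
pose N := complex_integral m (fun z => G z * (G z)^*%C).
have N0 : N != 0 by exact: (@complex_integral_sqr_neq0 _ _ m X_compact G y0).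
pose Gc : X -> R[i]^o := fun z => (G z)^*%C.
have cGc : continuous Gc by exact: conj_continuous.
(* Dividing by [N] in advance makes the product below exactly [tensor u v]. *)
pose Nv : X -> R[i]^o := fun y => N^-1 * v y.
have cNv : continuous Nv by move=> y; apply: cvgM; [exact: cvg_cst|exact: cv].
rewrite [tensor u v](_ : _ = star m (tensor u G) (tensor Gc Nv)).
  by apply: (Istar _ _ _ (IG _ cu)).2; exact: M_alg_tensor.
rewrite (star_tensorl u cG (M_alg_tensor cGc cNv)).
apply/funext => -[x y]; rewrite /tensor /=; congr (_ * _).
have cGG : continuous ((fun z => G z * (G z)^*%C) : X -> R[i]^o).
  by move=> z; apply: cvgM; [exact: cG|exact: cGc].
transitivity (complex_integral m (fun z => Nv y * (G z * (G z)^*%C))).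
  by rewrite (complex_integralZl m X_compact _ cGG) -/N /Nv mulrAC mulVf ?mul1r.
by congr complex_integral; apply/funext => z; rewrite [RHS]mulrA [RHS]mulrC.
Qed.

Lemma ideal_interpolation f (s : seq X) : M_alg f ->
  exists2 h, I h & forall x y, y \in s -> h (x, y) = f (x, y).
Proof.
have [IM I0 IZD _] := idealI.
move=> Mf; elim: s => [|y s [h Ih hf]]; first by exists 0.
(* A repeated column is already matched by [h]; separation applies only to a new one. *)
have [ys|ys] := boolP (y \in s).
  by exists h => // x z; rewrite inE => /predU1P[->|]; exact: hf.
have [v [cv vy vs]] := metrizable_separation X_metrizable ys.
pose u : X -> R[i]^o := fun x => f (x, y) - h (x, y).
have cu : continuous u.
  move=> x; have cf := @M_alg_column f y Mf x.
  exact: cvgB cf (@M_alg_column h y (IM _ Ih) x).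
(* The correction repairs column [y], where [v] is 1, and leaves the columns in [s] alone, where [v]
   is 0. *)
exists (1 *: tensor u v + h); first exact: IZD (ideal_tensor cu cv) Ih.
move=> x z; rewrite scale1r inE => /predU1P[->|zs].
  by rewrite /tensor /= fctE /= vy mulr1 subrK.
by rewrite fctE /tensor /= (vs _ zs) mulr0 add0r hf.
Qed.

(** Plays the part of a net in [I] indexed by finite lists of columns; one filter serves both
    topologies. *)
Definition interpolants f : set_system (X * X -> R[i]^o) :=
  filter_from [set: seq X]
    (fun s => [set h | I h /\ forall x y, y \in s -> h (x, y) = f (x, y)]).

(** Concatenating lists refines two base sets at once, and interpolation makes every base set
    nonempty. *)
Lemma interpolants_filter f : M_alg f -> ProperFilter (interpolants f).
Proof.
move=> Mf; apply: filter_from_proper; last first.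
  by move=> s _; have [h Ih hf] := ideal_interpolation s Mf; exists h.
apply: filter_from_filter; first by exists [::].
move=> s t _ _; exists (s ++ t) => // h [Ih hf].
by split; split => // x y yst; apply: hf; rewrite mem_cat yst ?orbT.
Qed.

(** The empty list asks for membership in [I] alone. *)
Lemma interpolants_ideal f : interpolants f I.
Proof. by exists [::] => // h []. Qed.

(** On the column of [y], members of the base set of [[:: y]] equal [f], so every entourage is met
    by reflexivity. *)
Lemma interpolants_cvg_columns f : M_alg f ->
  {family @columns X, interpolants f --> f}.
Proof.
move=> Mf; have PF := interpolants_filter Mf.
apply/fam_cvgP => _ [y _ <-] P /uniform_nbhs[E [entE EP]].
exists [:: y] => // h [_ hf]; apply: EP => -[x z] /= ->.
by rewrite hf ?mem_head//; exact: entourage_refl.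
Qed.

Lemma interpolants_cvg_ptws f : M_alg f -> {ptws, interpolants f --> f}.
Proof.
move=> Mf; have PF := interpolants_filter Mf.
(* The column through the point suffices: there the interpolants take the value [f (x, y)]
   itself. *)
apply/pointwise_cvgP => -[x y] P fP; exists [:: y] => // h [_ hf] /=.
by rewrite hf ?mem_head//; exact: nbhs_singleton.
Qed.

(** Any continuous [f] is the column-wise limit of a proper filter containing [I], so it lies in
    [I]. *)
Lemma ideal_cc_closed_full : cc_closed I -> I = @M_alg R X.
Proof.
have [IM _ _ _] := idealI.
move=> clI; apply/seteqP; split=> // f Mf.
have PF := interpolants_filter Mf.
apply: (closed_subspace_cvg clI IM (interpolants_ideal f)) => //.
exact: interpolants_cvg_columns.
Qed.

Lemma ideal_pc_closed_full : pc_closed I -> I = @M_alg R X.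
Proof.
have [IM _ _ _] := idealI.
move=> clI; apply/seteqP; split=> // f Mf.
have PF := interpolants_filter Mf.
apply: (closed_subspace_cvg clI IM (interpolants_ideal f)) => //.
exact: interpolants_cvg_ptws.
Qed.

End ideal.

Theorem corollary5p4 (R : realType) (X : ptopologicalType)
    (m : probability (borel X) R) :
  compact [set: X] ->
  metrizable R X ->
  measure_support m = [set: X] ->
  (~ exists I : set (X * X -> R[i]^o),
      [/\ two_sided_ideal m I, nontrivial_ideal I, cc_closed I & rc_closed I]) /\
  (~ exists I : set (X * X -> R[i]^o),
      [/\ two_sided_ideal m I, nontrivial_ideal I & pc_closed I]).
Proof.
move=> X_compact X_metrizable m_support; split.
  move=> [I [idealI [I0 IM] ccI _]]; apply: IM.
  exact: (ideal_cc_closed_full X_compact X_metrizable m_support idealI I0 ccI).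
move=> [I [idealI [I0 IM] pcI]]; apply: IM.
exact: (ideal_pc_closed_full X_compact X_metrizable m_support idealI I0 pcI).
Qed.
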